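(* The class of $\mathcal{U}^{\pm}$-graphs is strictly contained in the class of $\mathcal{U}^{\pm,+-}$-graphs, which is strictly contained in the class of $\mathcal{U}$-graphs.
   Context: All graphs are finite, simple and undirected. Unit intervals are real intervals of length one: closed $[x,x+1]$, open $(x,x+1)$, open-closed $(x,x+1]$, closed-open $[x,x+1)$. Let $\mathcal{U}^{++}$, $\mathcal{U}^{--}$, $\mathcal{U}^{+-}$ be the sets of all closed, open, resp. closed-open unit intervals, $\mathcal{U}$ the set of all unit intervals, $\mathcal{U}^{\pm}=\mathcal{U}^{++}\cup\mathcal{U}^{--}$ and $\mathcal{U}^{\pm,+-}=\mathcal{U}^{++}\cup\mathcal{U}^{--}\cup\mathcal{U}^{+-}$. For a family $\mathcal{N}$ of intervals, $G$ is an $\mathcal{N}$-graph if there is $I:V(G)\to\mathcal{N}$ with distinct $u,v$ adjacent iff $I(u)\cap I(v)\neq\emptyset$. *)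

(* Defs.v *)
From mathcomp Require Export all_boot all_order all_algebra.
From mathcomp Require Export all_classical reals.

Set Implicit Arguments.
Unset Strict Implicit.
Unset Printing Implicit Defensive.

Local Open Scope ring_scope.
Local Open Scope classical_set_scope.

Record sgraph := SGraph {
  vertex :> finType;
  adj : rel vertex;
  adj_sym : symmetric adj;
  adj_irr : irreflexive adj
}.

Definition Ucc (R : realType) : set (set R) :=
  [set A | exists x : R, A = `[x, x + 1]].
Definition Uoo (R : realType) : set (set R) :=
  [set A | exists x : R, A = `]x, x + 1[].
Definition Uco (R : realType) : set (set R) :=
  [set A | exists x : R, A = `[x, x + 1[].
Definition Uoc (R : realType) : set (set R) :=
  [set A | exists x : R, A = `]x, x + 1]].

Definition Upm (R : realType) : set (set R) := @Ucc R `|` @Uoo R.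
Definition Upm_co (R : realType) : set (set R) := @Ucc R `|` @Uoo R `|` @Uco R.
Definition Uall (R : realType) : set (set R) :=
  @Ucc R `|` @Uoo R `|` @Uco R `|` @Uoc R.

Arguments Ucc R : clear implicits.
Arguments Uoo R : clear implicits.
Arguments Uco R : clear implicits.
Arguments Uoc R : clear implicits.
Arguments Upm R : clear implicits.
Arguments Upm_co R : clear implicits.
Arguments Uall R : clear implicits.

(* Classes of graphs are plain predicates: [set sgraph] is ruled out by
   universe constraints, since [sgraph] quantifies over [finType]. *)
Definition graph_class := sgraph -> Prop.

Definition Ngraph (R : realType) (N : set (set R)) : graph_class := fun G =>
  exists I : G -> set R,
    (forall v, N (I v)) /\
    (forall u v : G, u != v -> (adj u v <-> I u `&` I v !=set0)).

Definition strictly_contained (C D : graph_class) : Prop :=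
  (forall G, C G -> D G) /\ (exists G, D G /\ ~ C G).

(* Main.v *)
Require Import Defs.
From mathcomp Require Import lra.

(** A unit interval is determined by its left endpoint and by which of its two
    endpoints it contains.  In an induced claw the middle leaf must be open and
    at the same position as the centre, which is closed, and the outer leaves
    lie at distance exactly one from the centre.  Two adjacent claw centres
    [c], [d] therefore sit at distance one, and a vertex adjacent to both of
    them, but to no further leaf of the claw at [c] and not to some leaf [f] of
    the claw at [d], occupies the position of [d], contains its endpoint on the
    side of [c], and misses the other one.  This separates the first two
    classes.  Adding the mirror image of that vertex forces half-open intervals
    of both kinds, which separates the last two. *)

Set Implicit Arguments.
Unset Strict Implicit.
Unset Printing Implicit Defensive.

Import Order.TTheory GRing.Theory Num.Theory.

Local Open Scope ring_scope.
Local Open Scope classical_set_scope.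

Section UnitIntervals.
Variable R : realType.

Record unit_itv := UnitItv { pos : R; lclosed : bool; rclosed : bool }.

Definition itv_set (a : unit_itv) : set R :=
  [set` Interval (BSide (lclosed a) (pos a)) (BSide (~~ rclosed a) (pos a + 1))].

Definition meets (a b : unit_itv) : bool :=
  (pos a < pos b + 1 ?<= if lclosed a && rclosed b) &&
  (pos b < pos a + 1 ?<= if lclosed b && rclosed a).

Definition mirror (a : unit_itv) : unit_itv :=
  UnitItv (- pos a) (rclosed a) (lclosed a).

Lemma itv_set_meets (a b : unit_itv) :
  itv_set a `&` itv_set b !=set0 <-> meets a b.
Proof.
case: a b => [x l r] [y l' r']; rewrite /meets /itv_set /=; split.
  by move=> [z [/=]]; rewrite !in_itv /=;
    move: l r l' r' => [] [] [] [] /= /andP[? ?] /andP[? ?]; apply/andP; lra.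
(* The witness is the midpoint between the larger left end and the smaller right end. *)
move=> /andP[h1 h2]; exists ((x + y + 1) / 2); split; rewrite /= in_itv /=;
  by move: l r l' r' h1 h2 => [] [] [] [] /= h1 h2; apply/andP; lra.
Qed.

Lemma meetsC (a b : unit_itv) : meets a b = meets b a.
Proof. by rewrite /meets andbC. Qed.

Lemma meets_mirror (a b : unit_itv) : meets (mirror a) (mirror b) = meets a b.
Proof.
case: a b => [x l r] [y l' r']; rewrite /meets /=.
by move: l r l' r' => [] [] [] [] /=; apply/andP/andP; lra.
Qed.

Lemma meets_pos (a b : unit_itv) : meets a b ->
  pos a <= pos b + 1 /\ (pos a = pos b + 1 -> lclosed a && rclosed b).
Proof.
rewrite /meets => /andP[+ _]; case: (lclosed a && rclosed b) => /= h; split=> //; lra.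
Qed.

Lemma meetsN_pos (a b : unit_itv) : pos a <= pos b -> ~~ meets a b ->
  pos a + 1 <= pos b /\ (pos b = pos a + 1 -> ~~ (rclosed a && lclosed b)).
Proof.
move=> ab; rewrite /meets [lclosed b && _]andbC negb_and.
have -> : pos a < pos b + 1 ?<= if lclosed a && rclosed b.
  by case: (_ && _) => /=; lra.
by case: (rclosed a && lclosed b) => /= h; split=> //; lra.
Qed.

(** Disjointness spaces the leaves at least one apart, while meeting [c] keeps the outer two within
    one of it, so every bound is tight. At distance exactly one, meeting means that both touching
    endpoints are contained. *)
Lemma sorted_claw (a b c d : unit_itv) :
    pos a <= pos b -> pos b <= pos d ->
    meets c a -> meets c d -> ~~ meets a b -> ~~ meets b d ->
  [/\ pos a = pos c - 1, pos b = pos c, pos d = pos c + 1 &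
    [&& lclosed c, rclosed c, rclosed a, lclosed d, ~~ lclosed b & ~~ rclosed b]].
Proof.
move=> ab bd /meets_pos[ca ca'] + /(meetsN_pos ab)[ab1 ab1'] /(meetsN_pos bd)[bd1 bd1'].
rewrite meetsC => /meets_pos[dc dc'].
have ea : pos a = pos c - 1 by lra.
have eb : pos b = pos c by lra.
have ed : pos d = pos c + 1 by lra.
split=> //; have /andP[-> ra] : lclosed c && rclosed a by apply: ca'; lra.
have /andP[ld ->] := dc' ed; rewrite ra ld /=.
have : ~~ (rclosed a && lclosed b) by apply: ab1'; lra.
have : ~~ (rclosed b && lclosed d) by apply: bd1'; lra.
by rewrite ra ld /= andbT => -> ->.
Qed.

Lemma claw_center_closed (a b c d : unit_itv) :
    meets c a -> meets c b -> meets c d ->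
    ~~ meets a b -> ~~ meets a d -> ~~ meets b d ->
  lclosed c && rclosed c.
Proof.
wlog ab : a b / pos a <= pos b => [hw|].
  have [/hw|/ltW/hw] := leP (pos a) (pos b); first exact.
  by move=> h ca cb cd nab nad nbd; apply: h => //; rewrite meetsC.
move=> ca cb cd nab nad nbd; have ndb := nbd; rewrite meetsC in ndb.
have nda := nad; rewrite meetsC in nda.
have [bd|/ltW db] := leP (pos b) (pos d).
  by have [_ _ _ /and3P[-> ->]] := sorted_claw ab bd ca cd nab nbd.
have [ad|/ltW da] := leP (pos a) (pos d).
  by have [_ _ _ /and3P[-> ->]] := sorted_claw ad db ca cb nad ndb.
by have [_ _ _ /and3P[-> ->]] := sorted_claw da ab cd cb nda nab.
Qed.

(** The middle leaf of a claw is open, so the closed leaf [d] is an outer one, on the right by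
    [pos c <= pos d]. The disjunction records which of [a] and [b] is the middle leaf. *)
Lemma claw_closed_leaf (a b c d : unit_itv) :
    meets c a -> meets c b -> meets c d ->
    ~~ meets a b -> ~~ meets a d -> ~~ meets b d ->
    lclosed d -> rclosed d -> pos c <= pos d ->
  pos d = pos c + 1 /\
  (pos a = pos c /\ (pos b = pos c - 1 /\ rclosed b) \/
   pos b = pos c /\ (pos a = pos c - 1 /\ rclosed a)).
Proof.
wlog ab : a b / pos a <= pos b => [hw|].
  have [/hw|/ltW/hw] := leP (pos a) (pos b); first exact.
  move=> h ca cb cd nab nad nbd ld rd c_d; rewrite meetsC in nab.
  have [-> hab] := h cb ca cd nab nbd nad ld rd c_d.
  by split=> //; case: hab; [right|left].
move=> ca cb cd nab nad nbd ld rd c_d; have ndb := nbd; rewrite meetsC in ndb.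
have nda := nad; rewrite meetsC in nda.
have [bd|/ltW db] := leP (pos b) (pos d).
  have [? ? ? /and4P[_ _ ra _]] := sorted_claw ab bd ca cd nab nbd.
  by split=> //; right.
have [ad|/ltW da] := leP (pos a) (pos d).
  have [_ _ _] := sorted_claw ad db ca cb nad ndb.
  by rewrite ld !andbF.
have [? ? ? _] := sorted_claw da ab cd cb nda nab; lra.
Qed.

(** Each centre is a leaf of the other's claw. The pattern does not tell which of [a] and [b] is the
    middle leaf, so [v] misses both; missing [f] makes [f] an outer leaf. *)
Definition two_claws (T : Type) (m : T -> T -> bool) (a b c d e f v : T) : bool :=
  [&& [&& m c a, m c b & m c d], [&& ~~ m a b, ~~ m a d & ~~ m b d],
      [&& m d f, m d e & m d c], [&& ~~ m f e, ~~ m f c & ~~ m e c]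
    & [&& m v c, m v d, ~~ m v a, ~~ m v b & ~~ m v f]].

Lemma two_claws_left (a b c d e f v : unit_itv) :
  two_claws meets a b c d e f v -> pos c <= pos d -> lclosed v && ~~ rclosed v.
Proof.
move=> /and5P[/and3P[ca cb cd] /and3P[nab nad nbd] /and3P[df de dc]].
move=> /and3P[nfe nfc nec] /and5P[vc vd nva nvb nvf] c_d.
have /andP[lc rc] := claw_center_closed ca cb cd nab nad nbd.
have /andP[ld rd] := claw_center_closed df de dc nfe nfc nec.
have [ed hab] := claw_closed_leaf ca cb cd nab nad nbd ld rd c_d.
(* In the mirror image, the leaf [c] of the claw at [d] lies to the right of its centre. *)
have := @claw_closed_leaf (mirror f) (mirror e) (mirror d) (mirror c).
rewrite !meets_mirror /= lerN2 => /(_ df de dc nfe nfc nec rc lc c_d)[_ hef].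
have [vc1 _] := meets_pos vc; have [vd1 _] := meets_pos vd.
have dv := vd; rewrite meetsC in dv; have [dv1 _] := meets_pos dv.
(* Missing the middle leaf at [c] keeps [v] a full unit away from [c]; meeting both centres then
   leaves only the position of [d]. *)
have far x : pos x = pos c -> ~~ meets v x -> pos v = pos d.
  move=> xc nvx; have [vx|/ltW xv] := leP (pos v) (pos x).
    have [? _] := meetsN_pos vx nvx; lra.
  rewrite meetsC in nvx; have [? _] := meetsN_pos xv nvx; lra.
have evd : pos v = pos d by case: hab => -[/far h _]; exact: h.
have /andP[-> _] : lclosed v && rclosed c by apply: (meets_pos vc).2; lra.
have vf : pos v <= pos f by case: hef => -[fd [fd']]; lra.
(* As the middle leaf, [f] would share its position with [v] and meet it. As the outer one it
   contains its left end, which is the right end of [v], so [v] must omit that point. *)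
have [efd lf] : pos f = pos d + 1 /\ lclosed f.
  have := (meetsN_pos vf nvf).1.
  by case: hef => [[fd _]|[_ [fd lf]]] vf1; split=> //; lra.
have := (meetsN_pos vf nvf).2.
by rewrite lf andbT; apply; lra.
Qed.

Lemma two_claws_mirror (a b c d e f v : unit_itv) :
  two_claws meets (mirror a) (mirror b) (mirror c) (mirror d)
    (mirror e) (mirror f) (mirror v) = two_claws meets a b c d e f v.
Proof. by rewrite /two_claws !meets_mirror. Qed.

Lemma two_claws_right (a b c d e f v : unit_itv) :
  two_claws meets a b c d e f v -> pos d <= pos c -> rclosed v && ~~ lclosed v.
Proof.
rewrite -two_claws_mirror => /two_claws_left h dc; apply: h => /=; lra.
Qed.

Lemma UpmP (A : set R) :
  Upm R A -> exists a, A = itv_set a /\ lclosed a = rclosed a.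
Proof.
by case=> -[x ->]; [exists (UnitItv x true true) | exists (UnitItv x false false)].
Qed.

(** The implication excludes exactly the open-closed kind. *)
Lemma Upm_coP (A : set R) :
  Upm_co R A -> exists a, A = itv_set a /\ (rclosed a ==> lclosed a).
Proof.
by case=> [[] | ] [x ->];
  [exists (UnitItv x true true) | exists (UnitItv x false false)
  |exists (UnitItv x true false)].
Qed.

Lemma itv_set_Upm_co (a : unit_itv) :
  rclosed a ==> lclosed a -> Upm_co R (itv_set a).
Proof.
by case: a => x [] [] // _; [left; left | right | left; right]; exists x.
Qed.

Lemma itv_set_Uall (a : unit_itv) : Uall R (itv_set a).
Proof.
by case: a => x [] []; [left; left; left | left; right | right | left; left; right];
  exists x.
Qed.

Lemma Ngraph_unit_itv (N : set (set R)) (P : unit_itv -> Prop) (G : sgraph) :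
    (forall A, N A -> exists a, A = itv_set a /\ P a) -> Ngraph N G ->
  exists J : G -> unit_itv, (forall v, P (J v)) /\
    forall u v : G, u != v -> adj u v = meets (J u) (J v).
Proof.
move=> NP [I [NI Iadj]]; have [J HJ] := choice (fun v => NP _ (NI v)).
exists J; split=> [v|u v uv]; first exact: (HJ v).2.
by apply/idP/idP=> [/(Iadj u v uv)|h]; rewrite ?(HJ u).1 ?(HJ v).1;
   [move/itv_set_meets | apply/(Iadj u v uv); rewrite (HJ u).1 (HJ v).1;
    apply/itv_set_meets].
Qed.

Section IntersectionGraph.
Variables (V : finType) (J : V -> unit_itv).

Definition itv_adj : rel V := fun u v => (u != v) && meets (J u) (J v).

Lemma itv_adj_sym : symmetric itv_adj.
Proof. by move=> u v; rewrite /itv_adj eq_sym meetsC. Qed.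

Lemma itv_adj_irr : irreflexive itv_adj.
Proof. by move=> u; rewrite /itv_adj eqxx. Qed.

Definition itv_graph : sgraph := SGraph itv_adj_sym itv_adj_irr.

Lemma Ngraph_itv_graph (N : set (set R)) :
  (forall v, N (itv_set (J v))) -> Ngraph N itv_graph.
Proof.
move=> NJ; exists (itv_set \o J); split=> // u v uv /=.
by rewrite /itv_adj uv; split=> /itv_set_meets.
Qed.

End IntersectionGraph.

(* The claws are centred at [1, 2] and [2, 3]; the intervals of indices 6 and 7
   are the half-open ones. *)
Definition eight_itvs : seq unit_itv :=
  [:: UnitItv 0%:R true true; UnitItv 1%:R false false; UnitItv 1%:R true true;
      UnitItv 2%:R true true; UnitItv 2%:R false false; UnitItv 3%:R true true;
      UnitItv 2%:R true false; UnitItv 1%:R false true].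

Definition nth_itv (i : nat) : unit_itv := nth (UnitItv 0 true true) eight_itvs i.

Lemma two_claws_co :
  two_claws meets (nth_itv 0) (nth_itv 1) (nth_itv 2) (nth_itv 3)
    (nth_itv 4) (nth_itv 5) (nth_itv 6).
Proof.
by rewrite /two_claws /meets /nth_itv /= !natr1 !ltr_nat !ler_nat.
Qed.

(** Reflecting the line at 2 reverses the indices 0 to 5 and swaps 6 and 7. *)
Lemma two_claws_oc :
  two_claws meets (nth_itv 5) (nth_itv 4) (nth_itv 3) (nth_itv 2)
    (nth_itv 1) (nth_itv 0) (nth_itv 7).
Proof.
by rewrite /two_claws /meets /nth_itv /= !natr1 !ltr_nat !ler_nat.
Qed.

(** Only the last interval of the list is open-closed, so its prefixes of lengths 7 and 8 serve the
    two separations. *)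
Definition prefix_graph (n : nat) : sgraph :=
  itv_graph (fun i : 'I_n => nth_itv i).

(** Indexing by [nat] lets the pattern on concrete numerals be rewritten from the list to any
    representation. *)
Lemma prefix_graph_unit_itv (N : set (set R)) (P : unit_itv -> Prop) (n : nat) :
    (forall A, N A -> exists a, A = itv_set a /\ P a) ->
    Ngraph N (prefix_graph n.+1) ->
  exists K : nat -> unit_itv, (forall i, P (K i)) /\
    forall i j, (i <= n)%N -> (j <= n)%N -> i != j ->
      meets (nth_itv i) (nth_itv j) = meets (K i) (K j).
Proof.
move=> NP /(Ngraph_unit_itv NP)[J [PJ Jadj]].
exists (fun i => J (inord i : 'I_n.+1)); split=> // i j le_in le_jn ij.
have ij' : (inord i : 'I_n.+1) != inord j by rewrite -val_eqE /= !inordK.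
by rewrite -Jadj //= /itv_adj ij' !inordK.
Qed.

Lemma prefix7_Upm_co : Ngraph (Upm_co R) (prefix_graph 7).
Proof.
apply: Ngraph_itv_graph => -[i lti]; apply: itv_set_Upm_co; move: lti.
by do 7?[case: i => [|i] //].
Qed.

Lemma prefix7_not_Upm : ~ Ngraph (Upm R) (prefix_graph 7).
Proof.
move=> /(prefix_graph_unit_itv UpmP)[K [PK Kadj]].
have := two_claws_co; rewrite /two_claws !Kadj // => tcK.
have [/(two_claws_left tcK)|/ltW/(two_claws_right tcK)] := leP (pos (K 2)) (pos (K 3)).
  by rewrite PK andbN.
by rewrite PK andbN.
Qed.

Lemma prefix8_Uall : Ngraph (Uall R) (prefix_graph 8).
Proof.
by apply: Ngraph_itv_graph => i; exact: itv_set_Uall.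
Qed.

(** A representation may place the centres in either order; the order decides which of the vertices
    6 and 7 gets an open-closed interval. *)
Lemma prefix8_not_Upm_co : ~ Ngraph (Upm_co R) (prefix_graph 8).
Proof.
move=> /(prefix_graph_unit_itv Upm_coP)[K [PK Kadj]].
have := two_claws_co; rewrite /two_claws !Kadj // => co.
have := two_claws_oc; rewrite /two_claws !Kadj // => oc.
have [h|/ltW h] := leP (pos (K 2)) (pos (K 3)).
  by have := two_claws_right oc h; have := PK 7; case: lclosed; case: rclosed.
by have := two_claws_right co h; have := PK 6; case: lclosed; case: rclosed.
Qed.

End UnitIntervals.

Theorem theorem6 (R : realType) :
  strictly_contained (Ngraph (Upm R)) (Ngraph (Upm_co R)) /\
  strictly_contained (Ngraph (Upm_co R)) (Ngraph (Uall R)).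
Proof.
split; split.
- by move=> G [I [NI Iadj]]; exists I; split=> // v; left; exact: NI.
- exists (prefix_graph R 7); split; first exact: prefix7_Upm_co.
  exact: prefix7_not_Upm.
- by move=> G [I [NI Iadj]]; exists I; split=> // v; left; exact: NI.
- exists (prefix_graph R 8); split; first exact: prefix8_Uall.
  exact: prefix8_not_Upm_co.
Qed.
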